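(* Let $A$ be a complex antidiagonal matrix of size $n$ in standard form with entries $a_1,\dots,a_n$, and let $\Lambda_U$, $D$ and (for odd $n$) $C$ be as defined in the context. The following are equivalent. (a) $A$ is normal. (b) Both elements of every transpose pair in $A$ have the same modulus. (c) For even $n$, $\frac1{\sqrt2}\Lambda_U$ is unitary. For odd $n$, $\frac1{\sqrt2}C\Lambda_U$ is unitary. In particular, whenever $A$ is unitarily diagonalizable, $\frac{1}{\sqrt2}\Lambda_U$ unitarily diagonalizes $A$ to $D$ when $n$ is even, and $\frac1{\sqrt2}C\Lambda_U$ unitarily diagonalizes $A$ to $D$ when $n$ is odd (that is, $A=UDU^{-1}$ with $U$ the indicated unitary matrix).
   Context: An antidiagonal matrix is a square matrix whose only nonzero entries are at positions $(i,n+1-i)$. Standard form: for $n=2m$, $A_{m+1-j,\,m+j}=a_{2j-1}$, $A_{m+j,\,m+1-j}=a_{2j}$ ($1\le j\le m$); for $n=2m+1$, $A_{m+1,m+1}=a_1$, $A_{m+1-j,\,m+1+j}=a_{2j+1}$, $A_{m+1+j,\,m+1-j}=a_{2j}$ ($1\le j\le m$). $\sqrt{\cdot}$ is a complex square root. A transpose pair is a pair of indexed entries that are reflections of each other across the main diagonal. $A$ is normal if $AA^*=A^*A$. For $n=2m$: $D=\mathrm{diag}(-\sqrt{a_1}\sqrt{a_2},\sqrt{a_1}\sqrt{a_2},\dots,-\sqrt{a_{n-1}}\sqrt{a_n},\sqrt{a_{n-1}}\sqrt{a_n})$; for $1\le j\le m$, columns $2j-1,2j$ of $\Lambda_U$ are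 zero outside rows $m+1-j,\,m+j$, where they equal $\big(-\tfrac{\sqrt{a_{2j-1}}}{\sqrt{a_{2j}}},1\big)$ and $\big(\tfrac{\sqrt{a_{2j-1}}}{\sqrt{a_{2j}}},1\big)$, except that if $a_{2j-1}=a_{2j}=0$ they are replaced by a chosen pair of vectors of $\mathbb C^2$ that are orthonormal under the dot product. For $n=2m+1$: $D=\mathrm{diag}(a_1,-\sqrt{a_2}\sqrt{a_3},\sqrt{a_2}\sqrt{a_3},\dots,-\sqrt{a_{n-1}}\sqrt{a_n},\sqrt{a_{n-1}}\sqrt{a_n})$; column $1$ of $\Lambda_U$ has the single nonzero entry $\omega$ in row $m+1$, for any choice of nonzero $\omega\in\mathbb C$; for $1\le j\le m$, columns $2j,2j+1$ of $\Lambda_U$ are zero outside rows $m+1-j,\,m+1+j$, where they equal $\big(-\tfrac{\sqrt{a_{2j+1}}}{\sqrt{a_{2j}}},1\big)$ and $\big(\tfrac{\sqrt{a_{2j+1}}}{\sqrt{a_{2j}}},1\big)$, except that if $a_{2j}=a_{2j+1}=0$ they are replaced by a chosen pair of vectors of $\mathbb C^2$ that are orthonormal under the dot product. $C$ is the $n\times n$ identity matrix with its center element replaced by $\sqrt2$.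
   Formalization: (a)/(b) ⇒ (c) and the ''in particular'' part assume |ω| = 1 for odd n, and for pairs with both entries zero the inserted vectors are √2 times an orthonormal pair; as worded these fail (n=1, ω=2; n=2, A=0). *)

(* Defs.v *)
From mathcomp Require Import all_boot all_order all_algebra.
From mathcomp Require Export reals complex.
Set Implicit Arguments.
Unset Strict Implicit.
Unset Printing Implicit Defensive.
Import Order.TTheory GRing.Theory Num.Theory.
Local Open Scope ring_scope.

(* Rows, columns and the entries a_1, ..., a_n are numbered from 1, so the
   ordinal i : 'I_n stands for the number i.+1.  The entries are the values
   a 1, ..., a n of a function on nat; its other values are irrelevant.
   Both parities are treated together, with m = n./2. *)

(* The j-th transpose pair (1 <= j <= m) occupies the positions
   (row_up, row_low) and (row_low, row_up), where row_up = m + 1 - j and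
   row_low is m + j (n = 2m) or m + 1 + j (n = 2m + 1). *)
Definition row_up (n j : nat) : nat := (n./2 + 1 - j)%N.
Definition row_low (n j : nat) : nat :=
  if odd n then (n./2 + 1 + j)%N else (n./2 + j)%N.

(* Position (row_up, row_low) holds a_(2j-1) (n even) or a_(2j+1) (n odd);
   position (row_low, row_up) holds a_(2j) in both cases. *)
Definition idx_up (n j : nat) : nat :=
  if odd n then (2 * j + 1)%N else (2 * j - 1)%N.
Definition idx_low (j : nat) : nat := (2 * j)%N.

(* Columns 2j-1, 2j (n even) or 2j, 2j+1 (n odd) belong to pair j. *)
Definition col_pair (n c : nat) : nat := if odd n then c./2 else uphalf c.
Definition col_first (n c : nat) : bool := if odd n then ~~ odd c else odd c.

Section Antidiagonal.
Variables (C : numClosedFieldType) (n : nat).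
Implicit Types (A : 'M[C]_n) (a : nat -> C) (sq : C -> C).
Implicit Types (w : C) (x y : nat -> 'rV[C]_2).

(* rev_ord i is the position n + 1 - i. *)
Definition antidiagonal A : Prop :=
  forall i k : 'I_n, k != rev_ord i -> A i k = 0.

Definition standard_form a A : Prop :=
  [/\ antidiagonal A,
      forall (j : nat) (i k : 'I_n), (1 <= j <= n./2)%N ->
        i.+1 = row_up n j -> k.+1 = row_low n j ->
        A i k = a (idx_up n j) /\ A k i = a (idx_low j)
    & forall i : 'I_n, odd n -> i.+1 = n./2.+1 -> A i i = a 1%N].

Definition transpose_pair (p q : 'I_n * 'I_n) : Prop :=
  [/\ p.2 = rev_ord p.1, q = (p.2, p.1) & p != q].

Definition transpose_pairs_same_modulus A : Prop :=
  forall p q, transpose_pair p q -> `|A p.1 p.2| = `|A q.1 q.2|.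

(* The two nonzero coordinates (index 0 for row_up, 1 for row_low) of the
   first (b = true) or second (b = false) column of Lambda_U of pair j.
   x j and y j are the vectors chosen for that pair if both of its entries
   vanish.  If only a (idx_low j) vanishes, the column is undefined in the
   mathematical text; since t / 0 = 0 here, both columns of the pair are then
   (0, 1), so that Lambda_U is singular. *)
Definition block_col sq a x y (j : nat) (b : bool) : 'rV[C]_2 :=
  let r := sq (a (idx_up n j)) / sq (a (idx_low j)) in
  if (a (idx_up n j) == 0) && (a (idx_low j) == 0) then
    if b then x j else y j
  else \row_(l < 2) if l == 0 then (if b then - r else r) else 1.

Definition LambdaU sq a w x y : 'M[C]_n :=
  \matrix_(i < n, k < n)
    let j := col_pair n k.+1 in
    let v := block_col sq a x y j (col_first n k.+1) in
    if odd n && (k.+1 == 1%N) then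
      if i.+1 == n./2.+1 then w else 0
    else if i.+1 == row_up n j then v 0 0
    else if i.+1 == row_low n j then v 0 1
    else 0.

Definition Dmx sq a : 'M[C]_n :=
  diag_mx (\row_(k < n)
    let j := col_pair n k.+1 in
    let s := sq (a (idx_up n j)) * sq (a (idx_low j)) in
    if odd n && (k.+1 == 1%N) then a 1%N
    else if col_first n k.+1 then - s else s).

(* The center element is in row n./2 + 1; Cmx is used only for odd n. *)
Definition Cmx : 'M[C]_n :=
  diag_mx (\row_(k < n) if k.+1 == n./2.+1 then sqrtC 2 else 1).

Definition Umx sq a w x y : 'M[C]_n :=
  if odd n then (sqrtC 2)^-1 *: (Cmx *m LambdaU sq a w x y)
  else (sqrtC 2)^-1 *: LambdaU sq a w x y.

(* dotmx is the Hermitian dot product. *)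
Definition orthonormal_pair (u v : 'rV[C]_2) : Prop :=
  [/\ dotmx u u = 1, dotmx v v = 1 & dotmx u v = 0].

(* The arbitrary data of Lambda_U are scaled so that the columns they
   contribute to Umx are unit vectors: after multiplication by C and
   1 / sqrt 2 the center column is w, and the columns of a zero pair are
   x j / sqrt 2 and y j / sqrt 2. *)
Definition normalized_choice a w x y : Prop :=
  (odd n -> `|w| = 1) /\
  (forall j : nat, (1 <= j <= n./2)%N ->
     a (idx_up n j) = 0 -> a (idx_low j) = 0 ->
     orthonormal_pair ((sqrtC 2)^-1 *: x j) ((sqrtC 2)^-1 *: y j)).

Definition unitarily_diagonalizable A : Prop :=
  exists (P : 'M[C]_n) (d : 'rV[C]_n),
    P \is unitarymx /\ A = P *m diag_mx d *m invmx P.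

End Antidiagonal.

Arguments Dmx {C} n sq a.
Arguments LambdaU {C} n sq a w x y.
Arguments Umx {C} n sq a w x y.
Arguments normalized_choice {C} n a w x y.

(* Main.v *)
(* The antidiagonal pattern makes A A^* and A^* A diagonal, with i-th entries
   |A_(i, n+1-i)|^2 and |A_(n+1-i, i)|^2; this gives the equivalence of
   normality and equal moduli.  The columns of U coming from different transpose
   pairs have disjoint supports, so unitarity of U is orthonormality of each
   2-dimensional block, and a block (-r, 1), (r, 1) scaled by 1 / sqrt 2 is
   orthonormal iff |r|^2 = |a_up| / |a_low| = 1.  The identity A U = U D is
   likewise checked block by block. *)
Require Import Defs.
From mathcomp Require Import all_boot all_order all_algebra.
From mathcomp Require Import reals complex.
From mathcomp Require Import zify ring.
Set Implicit Arguments.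
Unset Strict Implicit.
Unset Printing Implicit Defensive.
Import Order.TTheory GRing.Theory Num.Theory.
Local Open Scope ring_scope.

(** * Arithmetic of row and column numbers *)

Section Positions.
Variable n : nat.
Implicit Types (i k l : 'I_n) (j : nat).

Definition center_col (k : nat) : bool := odd n && (k.+1 == 1%N).

Lemma pair_positions j : (1 <= j <= n./2)%N ->
  exists i k,
    [/\ i.+1 = row_up n j, k.+1 = row_low n j, i != k & k = rev_ord i].
Proof.
move=> hj; have ltup : ((row_up n j).-1 < n)%N by rewrite /row_up; lia.
have ltlow : ((row_low n j).-1 < n)%N.
  by rewrite /row_low; case: ifP; lia.
exists (Ordinal ltup), (Ordinal ltlow); split=> /=.
- by rewrite /row_up; lia.
- by rewrite /row_low; case: ifP; lia.
- rewrite -val_eqE /= /row_low /row_up; case: ifP; lia.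
- by apply: val_inj; rewrite /= /row_low /row_up; case: ifP; lia.
Qed.

(** Each case also locates the reflected row, so that [A i (rev_ord i)] and its transpose can be
    read off from [standard_form]. *)
Variant position_spec i : Prop :=
| PositionCenter of odd n & i.+1 = n./2.+1 & rev_ord i = i
| PositionUp j of (1 <= j <= n./2)%N & i.+1 = row_up n j
    & (rev_ord i).+1 = row_low n j
| PositionLow j of (1 <= j <= n./2)%N & i.+1 = row_low n j
    & (rev_ord i).+1 = row_up n j.

Lemma positionP i : position_spec i.
Proof.
have lt_in := ltn_ord i.
have [lt_im|le_mi] := ltnP i n./2.
  (* The witness solves [i.+1 = row_up n j] for [j]; the two further ones solve
     [i.+1 = row_low n j], whose offset depends on the parity. *)
  by apply: (@PositionUp i (n./2 - i)); rewrite /= ?/row_low ?/row_up;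
    try case: ifP; lia.
have [odd_n|even_n] := boolP (odd n).
  have [im|nim] := eqVneq (i : nat) n./2.
    by apply: PositionCenter => //; [lia | apply: val_inj => /=; lia].
  by apply: (@PositionLow i (i - n./2));
    rewrite /= ?/row_low ?/row_up ?odd_n; lia.
by apply: (@PositionLow i (i.+1 - n./2));
  rewrite /= ?/row_low ?/row_up ?(negPf even_n); lia.
Qed.

Lemma row_up_inj j j' : (1 <= j <= n./2)%N -> (1 <= j' <= n./2)%N ->
  (row_up n j == row_up n j') = (j == j').
Proof. by rewrite /row_up; lia. Qed.

Lemma row_low_inj j j' : (row_low n j == row_low n j') = (j == j').
Proof. by rewrite /row_low; case: ifP; lia. Qed.

Lemma row_up_low j j' : (1 <= j <= n./2)%N -> (1 <= j' <= n./2)%N ->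
  (row_up n j == row_low n j') = false.
Proof. by rewrite /row_up /row_low; case: ifP; lia. Qed.

Lemma row_up_center j : (1 <= j <= n./2)%N -> (row_up n j == n./2.+1) = false.
Proof. by rewrite /row_up; lia. Qed.

Lemma row_low_center j : odd n -> (1 <= j <= n./2)%N ->
  (row_low n j == n./2.+1) = false.
Proof. by rewrite /row_low => ->; lia. Qed.

Lemma col_pair_bounds k : ~~ center_col k -> (1 <= col_pair n k.+1 <= n./2)%N.
Proof.
by have := ltn_ord k; rewrite /center_col /col_pair; case: ifP; lia.
Qed.

(** In the orthonormality check this turns the Kronecker delta of two columns of one pair into that
    of their flags. *)
Lemma col_pair_inj k l : ~~ center_col k -> ~~ center_col l ->
  col_pair n k.+1 = col_pair n l.+1 ->
  (col_first n k.+1 == col_first n l.+1) = (k == l).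
Proof.
rewrite -(inj_eq val_inj) /= /center_col /col_pair /col_first.
by case: ifP; lia.
Qed.

Lemma first_col j : (1 <= j <= n./2)%N ->
  exists k, [/\ ~~ center_col k, col_pair n k.+1 = j & col_first n k.+1].
Proof.
(* Counted from 0, this is the index of column 2j - 1 (n even) or 2j (n odd); [odd n] is read as 0
   or 1. *)
move=> hj; have lt_kn : ((idx_up n j - 1 - odd n) < n)%N.
  by rewrite /idx_up; case: ifP; lia.
exists (Ordinal lt_kn).
rewrite /center_col /col_pair /col_first /= /idx_up.
by have [odd_n|even_n] := boolP (odd n); split; rewrite /=; lia.
Qed.

End Positions.

(** * Normality of antidiagonal matrices *)

Section Antidiagonal.
Variables (C : numClosedFieldType) (n : nat).
Implicit Types (A B : 'M[C]_n) (i k l : 'I_n) (j : nat) (u v : 'rV[C]_2).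
Local Open Scope sesquilinear_scope.

Lemma mul_antidiagonal A B i k : antidiagonal A ->
  (A *m B) i k = A i (rev_ord i) * B (rev_ord i) k.
Proof.
move=> antiA; rewrite mxE (bigD1 (rev_ord i)) //= big1 ?addr0 // => l lni.
by rewrite antiA ?mul0r.
Qed.

Lemma antidiagonal_adjoint A : antidiagonal A -> antidiagonal (A ^t*).
Proof.
move=> antiA i k kni; rewrite !mxE antiA ?conjC0 //.
by apply: contra_neq kni => ->; rewrite rev_ordK.
Qed.

Lemma antidiagonal_normalP A : antidiagonal A ->
  A \is normalmx <-> forall i, `|A i (rev_ord i)| = `|A (rev_ord i) i|.
Proof.
move=> antiA; have antiA' := antidiagonal_adjoint antiA.
split=> [/normalmxP/matrixP nA i|sameA].
  have := nA i i; rewrite !mul_antidiagonal // !mxE -normCK mulrC -normCK.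
  by move/eqP; rewrite eqrXn2 // => /eqP.
apply/normalmxP/matrixP => i k; rewrite !mul_antidiagonal // !mxE.
have [<-|nik] := eqVneq i k; first by rewrite -normCK mulrC -normCK sameA.
(* Off the diagonal both products vanish, since [rev_ord] is an involution. *)
rewrite [A k _]antiA ?(inj_eq rev_ord_inj) // conjC0 mulr0.
by rewrite [A _ k]antiA ?mulr0 // rev_ordK eq_sym.
Qed.

(** Running over all rows only adds the center of an odd [n], where [rev_ord i = i] makes the
    equality trivial. *)
Lemma same_modulusP A :
  transpose_pairs_same_modulus A <->
  forall i, `|A i (rev_ord i)| = `|A (rev_ord i) i|.
Proof.
split=> [sameA i|sameA [i k] [i' k'] [/= -> [-> ->] _]]; last exact: sameA.
have [<- //|ni] := eqVneq i (rev_ord i).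
apply: (sameA (_, _) (_, _)); split=> //=.
by apply: contra_neq ni => -[].
Qed.

(** Since the inverse of [P] is its adjoint, the inner factors cancel in both products, and diagonal
    matrices commute. *)
Lemma diagonalizable_normal A : unitarily_diagonalizable A -> A \is normalmx.
Proof.
move=> [P [d [uP ->]]]; rewrite invmx_unitary //.
have PP B : P^t* *m (P *m B) = B.
  by rewrite mulmxA (mulmx1C (unitarymxP uP)) mul1mx.
apply/normalmxP; rewrite !trmx_mul !map_mxM trmxCK tr_diag_mx map_diag_mx.
by rewrite -!mulmxA !PP !(mulmxA (diag_mx _)) diag_mxC.
Qed.

(** * Vectors supported on one transpose pair or on the center *)

Lemma dotmx_sum m (u v : 'rV[C]_m) : dotmx u v = \sum_i u 0 i * (v 0 i)^*.
Proof. by rewrite dotmxE mxE; apply: eq_bigr => i _; rewrite !mxE. Qed.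

Definition center_vec (w : C) : 'rV[C]_n :=
  \row_i (if i.+1 == n./2.+1 then w else 0).

Definition pair_vec j v : 'rV[C]_n :=
  \row_i (if i.+1 == row_up n j then v 0 0
          else if i.+1 == row_low n j then v 0 1 else 0).

(** The two rows of a pair are distinct, so [pair_vec j] embeds the plane isometrically. *)
Lemma dotmx_pair_vec j u v : (1 <= j <= n./2)%N ->
  dotmx (pair_vec j u) (pair_vec j v) = dotmx u v.
Proof.
move=> hj; have [i [k [iE kE nik _]]] := pair_positions hj.
rewrite !dotmx_sum big_ord_recl big_ord1.
rewrite (bigD1 i) //= (bigD1 k) 1?eq_sym //= big1 => [|l /andP[li lk]].
  have lift01 : lift ord0 ord0 = 1 :> 'I_2 by apply: val_inj.
  by rewrite !mxE iE eqxx kE eqxx eq_sym row_up_low // addr0 lift01.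
have [lup llow] : l.+1 != row_up n j /\ l.+1 != row_low n j.
  by rewrite -iE -kE !eqSS.
by rewrite !mxE (negPf lup) (negPf llow) mul0r.
Qed.

Lemma dotmx_pair_vec_neq j j' u v :
  (1 <= j <= n./2)%N -> (1 <= j' <= n./2)%N -> j != j' ->
  dotmx (pair_vec j u) (pair_vec j' v) = 0.
Proof.
move=> hj hj' njj'; rewrite dotmx_sum big1 // => i _; rewrite !mxE.
have [->|_] := eqVneq i.+1 (row_up n j).
  by rewrite row_up_inj // row_up_low // (negPf njj') conjC0 mulr0.
have [->|_] := eqVneq i.+1 (row_low n j); last by rewrite mul0r.
by rewrite eq_sym row_up_low // row_low_inj (negPf njj') conjC0 mulr0.
Qed.

Lemma dotmx_pair_center j v w : odd n -> (1 <= j <= n./2)%N ->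
  dotmx (pair_vec j v) (center_vec w) = 0.
Proof.
move=> odd_n hj; rewrite dotmx_sum big1 // => i _; rewrite !mxE.
have [->|_] := eqVneq i.+1 (row_up n j).
  by rewrite row_up_center // conjC0 mulr0.
have [->|_] := eqVneq i.+1 (row_low n j); last by rewrite mul0r.
by rewrite row_low_center // conjC0 mulr0.
Qed.

Lemma dotmx_center w : odd n ->
  dotmx (center_vec w) (center_vec w) = `|w| ^+ 2.
Proof.
move=> odd_n; have ltn2 : (n./2 < n)%N by lia.
rewrite dotmx_sum (bigD1 (Ordinal ltn2)) //= big1 => [|i ni].
  by rewrite !mxE /= eqxx normCK addr0.
by rewrite !mxE eqSS (negPf (ni : i != n./2 :> nat)) mul0r.
Qed.

Lemma dotmxC m (u v : 'rV[C]_m) : dotmx v u = (dotmx u v)^*.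
Proof.
rewrite !dotmx_sum rmorph_sum; apply: eq_bigr => i _.
by rewrite rmorphM /= conjCK mulrC.
Qed.

Lemma orthonormal_pair_dotmx u v : orthonormal_pair u v ->
  forall b b' : bool,
    dotmx (if b then u else v) (if b' then u else v) = (b == b')%:R.
Proof. by move=> [uu vv uv] [] [] //=; rewrite dotmxC uv conjC0. Qed.

(** * The columns of [Umx] and its unitarity *)

Variables (sq : C -> C) (a : nat -> C) (w : C) (x y : nat -> 'rV[C]_2).
Hypothesis hsq : forall z, sq z ^+ 2 = z.

Lemma sq_eq0 z : (sq z == 0) = (z == 0).
Proof. by rewrite -{2}[z]hsq sqrf_eq0. Qed.

(** Squaring the modulus removes the dependence on the branch of [sq]. For [t = 0] both sides are
    0. *)
Lemma norm_sq_ratio z t : `|sq z / sq t| ^+ 2 = `|z| / `|t|.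
Proof. by rewrite -normrX expr_div_n !hsq normf_div. Qed.

Definition unit_block j b : 'rV[C]_2 :=
  (sqrtC 2)^-1 *: block_col n sq a x y j b.

(** Columns are written as rows of the transpose, the form used by [row_unitarymxP]. In the center
    column the square root of 2 in [Cmx] cancels the scaling, which leaves [w]. *)
Lemma col_UmxE k : row k (Umx n sq a w x y)^T =
  if center_col n k then center_vec w
  else pair_vec (col_pair n k.+1)
         (unit_block (col_pair n k.+1) (col_first n k.+1)).
Proof.
have sqrt2_neq0 : sqrtC 2 != 0 :> C by rewrite sqrtC_eq0 pnatr_eq0.
apply/rowP => i; rewrite [LHS]mxE [LHS]mxE /Umx.
case: ifPn => [odd_n|even_n].
  rewrite mxE /Cmx mul_diag_mx !mxE /= -/(center_col n k).
  have [kc|nkc] := boolP (center_col n k).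
    rewrite mxE; case: ifP => _; last by rewrite !mulr0.
    by rewrite mulrA mulVf ?mul1r.
  have hj := col_pair_bounds nkc; rewrite !mxE.
  (* A pair column is zero in the center row, so [Cmx] acts on it as the identity. *)
  have [->|_] := eqVneq i.+1 (row_up n _).
    by rewrite row_up_center ?mul1r.
  have [->|_] := eqVneq i.+1 (row_low n _); last by rewrite !mulr0.
  by rewrite row_low_center ?mul1r.
by rewrite /center_col (negPf even_n) /= !mxE (negPf even_n) /=;
  case: ifP => _; [|case: ifP => _; [|rewrite mulr0]].
Qed.

Lemma normr_sqrt2V : `|(sqrtC 2)^-1 : C| ^+ 2 = 2^-1.
Proof. by rewrite normfV exprVn -normrX sqrtCK ger0_norm. Qed.

(** The hypothesis excludes the chosen vectors. If only [a (idx_low j)] vanishes, both sides are 1/2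
    because t / 0 = 0. *)
Lemma dotmx_unit_block j b : (a (idx_up n j) != 0) || (a (idx_low j) != 0) ->
  dotmx (unit_block j b) (unit_block j b) =
  2^-1 * (`|a (idx_up n j)| / `|a (idx_low j)| + 1).
Proof.
rewrite -negb_and => /negPf nz.
rewrite dotmx_sum big_ord_recl big_ord1 !mxE /block_col nz !mxE /=.
rewrite mulr1 -!normCK !normrM !exprMn normr_sqrt2V.
by case: b; rewrite ?normrN norm_sq_ratio mulrDr mulr1.
Qed.

Lemma unit_block_orthonormal j :
  normalized_choice n a w x y -> (1 <= j <= n./2)%N ->
  `|a (idx_up n j)| = `|a (idx_low j)| ->
  orthonormal_pair (unit_block j true) (unit_block j false).
Proof.
move=> [_ hxy] hj same.
have [/andP[/eqP up0 /eqP low0]|] :=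
    boolP ((a (idx_up n j) == 0) && (a (idx_low j) == 0)).
  by rewrite /unit_block /block_col up0 low0 eqxx /=; apply: hxy.
rewrite negb_and => nz.
(* One of the two entries is nonzero and their moduli agree, so neither vanishes. *)
have low_neq0 : `|a (idx_low j)| != 0.
  by rewrite -[_ != 0]orbb -{1}same !normr_eq0.
split; rewrite ?dotmx_unit_block // ?same ?divff //; try by field.
rewrite -negb_and in nz; rewrite dotmx_sum big_ord_recl big_ord1 !mxE.
rewrite /block_col (negPf nz) !mxE /= mulr1 mulrN mulNr.
set e := _^-1; set r := _ / _.
(* Since [r] has modulus 1, the two coordinates contribute opposite terms to the dot product. *)
have -> : e * r * (e * r)^* = e * e^*.
  rewrite rmorphM /= mulrACA -[r * _]normCK norm_sq_ratio same divff //.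
  by rewrite mulr1.
by rewrite addNr.
Qed.

Lemma Umx_unitary : normalized_choice n a w x y ->
  (forall j, (1 <= j <= n./2)%N -> `|a (idx_up n j)| = `|a (idx_low j)|) ->
  Umx n sq a w x y \is unitarymx.
Proof.
move=> hN same; rewrite -trmx_unitary; apply/row_unitarymxP => k l.
rewrite !col_UmxE; case: ifPn => [kc|nkc]; case: ifPn => [lc|nlc].
- have /andP[odd_n /eqP[k0]] := kc; have /andP[_ /eqP[l0]] := lc.
  rewrite dotmx_center // hN.1 // expr1n.
  by have /eqP-> : k = l by apply: val_inj; rewrite /= k0 l0.
- have /andP[odd_n _] := kc.
  rewrite dotmxC dotmx_pair_center ?col_pair_bounds //.
  by rewrite conjC0; have [kl|//] := eqVneq k l; rewrite -kl kc in nlc.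
- have /andP[odd_n _] := lc; rewrite dotmx_pair_center ?col_pair_bounds //.
  by have [kl|//] := eqVneq k l; rewrite kl lc in nkc.
have [jj|njj] := eqVneq (col_pair n k.+1) (col_pair n l.+1); last first.
  rewrite dotmx_pair_vec_neq ?col_pair_bounds //.
  by have [kl|//] := eqVneq k l; rewrite kl eqxx in njj.
(* Two columns of the same pair: orthonormality reduces to that of the 2-dimensional block. *)
rewrite -(col_pair_inj nkc nlc jj) -jj dotmx_pair_vec ?col_pair_bounds //.
have hj := col_pair_bounds nkc.
rewrite -(orthonormal_pair_dotmx (unit_block_orthonormal hN hj (same _ hj))).
by case: (col_first n k.+1); case: (col_first n l.+1).
Qed.

(** The unit norm of the first column of the pair already forces the ratio of moduli to be 1, unless
    both entries vanish. *)
Lemma unitary_Umx_same j : Umx n sq a w x y \is unitarymx ->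
  (1 <= j <= n./2)%N -> `|a (idx_up n j)| = `|a (idx_low j)|.
Proof.
rewrite -trmx_unitary => /row_unitarymxP uU hj.
have [k [nkc kj _]] := first_col hj.
have := uU k k; rewrite !col_UmxE (negPf nkc) kj dotmx_pair_vec // eqxx /=.
have [/andP[/eqP-> /eqP->] //|] :=
    boolP ((a (idx_up n j) == 0) && (a (idx_low j) == 0)).
rewrite negb_and => nz; rewrite dotmx_unit_block // => h.
have ratio1 : `|a (idx_up n j)| / `|a (idx_low j)| = 1.
  apply: (addIr 1); apply: (@mulfI _ (2^-1));
    first by rewrite invr_eq0 pnatr_eq0.
  by rewrite h; field.
(* A zero denominator would make the ratio 0 instead of 1. *)
have [low0|low_neq0] := eqVneq `|a (idx_low j)| 0.
  by move: ratio1; rewrite low0 invr0 mulr0 => /esym/eqP; rewrite oner_eq0.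
by rewrite -[LHS](divfK low_neq0) ratio1 mul1r.
Qed.

(** * Standard form and the identity [A *m U = U *m D] *)

Lemma standard_formP A : standard_form a A ->
  (forall i, `|A i (rev_ord i)| = `|A (rev_ord i) i|) <->
  (forall j, (1 <= j <= n./2)%N -> `|a (idx_up n j)| = `|a (idx_low j)|).
Proof.
move=> [_ hA _]; split=> [same j hj|same i].
  have [i [k [iE kE _ kr]]] := pair_positions hj.
  by have [<- <-] := hA j i k hj iE kE; rewrite kr.
case: (positionP i) => [_ _ -> //|j hj iE rE|j hj iE rE].
  by have [-> ->] := hA _ _ _ hj iE rE; exact: same.
by have [-> ->] := hA _ _ _ hj rE iE; rewrite same.
Qed.

(* Equal moduli exclude a lone zero in idx_low, where t / 0 = 0 would break the
   first identity. *)
Lemma unit_block_eigen j b : `|a (idx_up n j)| = `|a (idx_low j)| ->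
  let v := unit_block j b in
  let s := sq (a (idx_up n j)) * sq (a (idx_low j)) in
  let d := if b then - s else s in
  a (idx_up n j) * v 0 1 = v 0 0 * d /\ a (idx_low j) * v 0 0 = v 0 1 * d.
Proof.
move=> same v s d.
have [low0|low_neq0] := eqVneq (a (idx_low j)) 0.
  have up0 : a (idx_up n j) = 0.
    by apply/eqP; rewrite -normr_eq0 same low0 normr0.
  (* With both entries zero the eigenvalue is zero, so any chosen vectors will do. *)
  have d0 : d = 0.
    have s0 : s = 0 by apply/eqP; rewrite mulf_eq0 !sq_eq0 low0 eqxx orbT.
    by rewrite /d s0 oppr0 if_same.
  by rewrite up0 low0 d0 !mul0r !mulr0.
have sq_neq0 : sq (a (idx_low j)) != 0 by rewrite sq_eq0.
rewrite /v /d /s /unit_block /block_col (negPf low_neq0) andbF !mxE /=.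
have := hsq (a (idx_up n j)); have := hsq (a (idx_low j)); move: sq_neq0.
(* Each entry becomes the square of its root, leaving rational identities in [up] and [low]. *)
move: (sq (a (idx_up n j))) (sq (a (idx_low j))) => up low low_neq <- <-.
have sqrt2_neq0 : sqrtC 2 != 0 :> C by rewrite sqrtC_eq0 pnatr_eq0.
by case: (b); split; field; rewrite ?low_neq ?sqrt2_neq0.
Qed.

(** Left multiplication by [A] exchanges the two rows of each pair up to factors, so every pair
    column reduces to [unit_block_eigen]; the center column is scaled by [a 1]. *)
Lemma mul_Umx_Dmx A : standard_form a A ->
  (forall j, (1 <= j <= n./2)%N -> `|a (idx_up n j)| = `|a (idx_low j)|) ->
  A *m Umx n sq a w x y = Umx n sq a w x y *m Dmx n sq a.
Proof.
move=> [antiA pairA centerA] same; apply/matrixP => i k.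
rewrite mul_antidiagonal // mul_mx_diag !mxE.
have UE l : Umx n sq a w x y l k = row k (Umx n sq a w x y)^T 0 l.
  by rewrite !mxE.
rewrite !UE col_UmxE; case: ifPn => [kc|nkc].
  have /andP[odd_n _] := kc; rewrite -/(center_col n k) kc !mxE.
  case: (positionP i) => [_ iE -> |j hj iE rE|j hj iE rE].
  - by rewrite centerA // mulrC.
  - by rewrite iE rE row_up_center // row_low_center // mulr0 mul0r.
  - by rewrite iE rE row_up_center // row_low_center // mulr0 mul0r.
rewrite -/(center_col n k) (negPf nkc).
have := col_pair_bounds nkc.
move: (col_pair n k.+1) (col_first n k.+1) => j b hj.
have /= [eigen_up eigen_low] := unit_block_eigen b (same j hj).
move: (unit_block j b) eigen_up eigen_low => v eigen_up eigen_low.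
rewrite !mxE; case: (positionP i) => [odd_n iE ->|j' hj' iE rE|j' hj' iE rE].
- rewrite iE ![n./2.+1 == _]eq_sym row_up_center // row_low_center //.
  by rewrite mulr0 mul0r.
- have [-> _] := pairA _ _ _ hj' iE rE.
  rewrite iE rE [row_low n j' == row_up n j]eq_sym.
  rewrite row_up_inj // row_low_inj !row_up_low //.
  by have [->|_] := eqVneq j' j; [exact: eigen_up | rewrite mulr0 mul0r].
- have [_ ->] := pairA _ _ _ hj' rE iE.
  rewrite iE rE [row_low n j' == row_up n j]eq_sym.
  rewrite row_up_inj // row_low_inj !row_up_low //.
  by have [->|_] := eqVneq j' j; [exact: eigen_low | rewrite mulr0 mul0r].
Qed.

End Antidiagonal.

(** * Equivalences and diagonalization over the complex numbers *)

Local Open Scope complex_scope.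

Theorem theorem5p16 (R : realType) (n : nat) (A : 'M[R[i]]_n)
    (a : nat -> R[i]) (sq : R[i] -> R[i])
    (w : R[i]) (x y : nat -> 'rV[R[i]]_2)
    (hA : standard_form a A)
    (hsq : forall z : R[i], sq z ^+ 2 = z)
    (hw : w != 0) :
  let U := Umx n sq a w x y in
  let D := Dmx n sq a in
  [/\ A \is normalmx <-> transpose_pairs_same_modulus A,
      U \is unitarymx -> A \is normalmx,
      normalized_choice n a w x y ->
        [<-> A \is normalmx; transpose_pairs_same_modulus A; U \is unitarymx]
    & normalized_choice n a w x y -> unitarily_diagonalizable A ->
        U \is unitarymx /\ A = U *m D *m invmx U].
Proof.
move=> U D; have [antiA _ _] := hA.
have normalP : A \is normalmx <-> transpose_pairs_same_modulus A.
  by rewrite same_modulusP; exact: antidiagonal_normalP.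
have sameP : transpose_pairs_same_modulus A <->
    forall j, (1 <= j <= n./2)%N -> `|a (idx_up n j)| = `|a (idx_low j)|.
  by rewrite same_modulusP; exact: standard_formP.
have unitary_same : U \is unitarymx -> transpose_pairs_same_modulus A.
  by move=> uU; apply/sameP => j;
    exact: (@unitary_Umx_same R[i] n sq a w x y hsq j uU).
have same_unitary : normalized_choice n a w x y ->
    transpose_pairs_same_modulus A -> U \is unitarymx.
  by move=> hN /sameP; exact: (Umx_unitary hsq).
have unitary_normal : U \is unitarymx -> A \is normalmx.
  by move/unitary_same; case: normalP.
split=> [||hN|hN diagA]; [exact: normalP | exact: unitary_normal | |].
  by split; [case: normalP | split; [exact: same_unitary | exact: unitary_normal]].
have /normalP sameA := diagonalizable_normal diagA.
have uU := same_unitary hN sameA; split=> //.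
(* Replacing [U *m D] by [A *m U] lets the invertible [U] cancel on the right. *)
rewrite -(mul_Umx_Dmx w x y hsq hA (proj1 sameP sameA)) mulmxK //.
exact: unitarymx_unit.
Qed.
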